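(* Let $t,d\ge 2$ be integers. There is a constant $C_d>0$ depending only on $d$ such that every $n$-vertex graph $G\in \mathcal{S}^d_t$ with $n\ge 2$ has a balanced separator of size at most $C_d\, t^{10}\, n^{1-\frac{1}{2d+8}}\log n$. In particular, the class $\mathcal{S}^d_t$ has strongly sublinear separators.
   Context: All graphs are finite and simple. For $d\ge 2$, a sphere in $\mathbb{R}^d$ is the boundary of a closed Euclidean ball of positive radius; $\mathcal{S}^{d}$ denotes the class of graphs that are intersection graphs of finite families of spheres in $\mathbb{R}^d$ (vertices are identified with spheres, two vertices adjacent iff the spheres intersect). The sphere dimension of a graph $G$ is the least $d$ with $G\in\mathcal{S}^d$ (where $\mathcal{S}^1$ is the class of circle graphs, i.e. intersection graphs of finite families of chords of a circle). For integers $t,d\ge 2$, $\mathcal{S}^d_t$ is the class of all graphs of sphere dimension at most $d$ that do not contain the complete bipartite graph $K_{t,t}$ as a (not necessarily induced) subgraph. A balanced separator of an $n$-vertex graph $G$ is a set $S\subseteq V(G)$ such that every component of $G-S$ has at most $\frac23 n$ vertices. A class $\mathcal{C}$ has strongly sublinear separators if there is $\epsilon>0$ and a constant $C$ such that every $n$-vertex graph that is an induced subgraph of a graph in $\mathcal{C}$ has a balanced separator of size at most $C n^{1-\epsilon}$. *)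

(* Defs.v *)
From Stdlib Require Import Rdefinitions Rpower.
From HB Require Import structures.
From mathcomp Require Import all_boot all_order all_algebra.
From mathcomp Require Import Rstruct.
Set Implicit Arguments. Unset Strict Implicit. Unset Printing Implicit Defensive.
Import Order.TTheory GRing.Theory Num.Theory.
Local Open Scope ring_scope.

Notation R := Rdefinitions.R.

Definition simple_graph (V : finType) (e : rel V) : Prop :=
  symmetric e /\ irreflexive e.

Definition dist2 (d : nat) (x y : 'rV[R]_d) : R :=
  \sum_(i < d) (x ord0 i - y ord0 i) ^+ 2.

Definition on_sphere (d : nat) (c : 'rV[R]_d) (r : R) (x : 'rV[R]_d) : Prop :=
  dist2 x c = r ^+ 2.

Definition spheres_meet (d : nat) (c1 : 'rV[R]_d) (r1 : R) (c2 : 'rV[R]_d) (r2 : R) :=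
  exists x : 'rV[R]_d, on_sphere c1 r1 x /\ on_sphere c2 r2 x.

Definition sphere_graph (d : nat) (V : finType) (e : rel V) : Prop :=
  exists (c : V -> 'rV[R]_d) (r : V -> R),
    (forall v, 0 < r v) /\
    (forall u v, u != v -> (e u v <-> spheres_meet (c u) (r u) (c v) (r v))).

Definition on_unit_circle (p : 'rV[R]_2) : Prop := dist2 p 0 = 1.

Definition on_segment (p q x : 'rV[R]_2) : Prop :=
  exists s : R, 0 <= s /\ s <= 1 /\ x = (1 - s) *: p + s *: q.

Definition circle_graph (V : finType) (e : rel V) : Prop :=
  exists (p q : V -> 'rV[R]_2),
    (forall v, on_unit_circle (p v) /\ on_unit_circle (q v) /\ p v != q v) /\
    (forall u v, u != v ->
       (e u v <-> exists x, on_segment (p u) (q u) x /\ on_segment (p v) (q v) x)).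

Definition in_S (d : nat) (V : finType) (e : rel V) : Prop :=
  if d == 1%N then circle_graph e else sphere_graph d e.

Definition sphere_dim_le (d : nat) (V : finType) (e : rel V) : Prop :=
  exists d' : nat, (1 <= d')%N /\ (d' <= d)%N /\ in_S d' e.

Definition contains_Ktt (t : nat) (V : finType) (e : rel V) : Prop :=
  exists A B : {set V}, #|A| = t /\ #|B| = t /\ [disjoint A & B] /\
    (forall a b, a \in A -> b \in B -> e a b).

Definition S_dt (d t : nat) (V : finType) (e : rel V) : Prop :=
  simple_graph e /\ sphere_dim_le d e /\ ~ contains_Ktt t e.

Definition del_rel (V : finType) (e : rel V) (S : {set V}) : rel V :=
  fun x y => [&& e x y, x \notin S & y \notin S].

Definition balanced_separator (V : finType) (e : rel V) (S : {set V}) : Prop :=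
  forall x, x \notin S ->
    (#|[set y | connect (del_rel e S) x y]|%:R <= (2%:R / 3%:R) * #|V|%:R :> R).

Definition graph_class := forall V : finType, rel V -> Prop.

Definition induced_sub (W V : finType) (h : rel W) (e : rel V) : Prop :=
  exists f : W -> V, injective f /\ forall x y, h x y = e (f x) (f y).

Definition strongly_sublinear (K : graph_class) : Prop :=
  exists eps : R, 0 < eps /\ exists C : R,
    forall (W : finType) (h : rel W),
      (exists (V : finType) (e : rel V), K V e /\ induced_sub h e) ->
      exists S : {set W}, balanced_separator h S /\
        #|S|%:R <= C * Rpower (#|W|%:R) (1 - eps).

(* Main.v *)
(* Two spheres with centres at distance D and radii r, s meet iff |r - s| <= D <= r + s;
   otherwise they are nested or mutually outside, and circle graphs satisfy the same
   criterion in dimension one.  It suffices to find, in every large induced subgraph, a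
   vertex cut that is sparse relative to both of its sides: removing such cuts one after
   another yields a balanced separator.  With N vertices and a parameter J there are two
   cases.  If at least N / J^(d+1) balls, up to a constant, share a point, then any two of
   their spheres meet or are nested; since pairwise meeting families have at most 2t
   members, there is a long chain of nested spheres, and the neighbourhood of some sphere
   in the middle of it is small because every sphere meets an interval of the chain and
   K_{t,t} is excluded.  Otherwise spheres of intermediate size are rare and a random
   sphere at the right scale is met by O(N / J) spheres only.  Both cuts are sparse enough
   when J^(2d+3) t^3 = O(N), so J ~ N^(1/(2d+8)) / t is admissible. *)
Require Import Defs.
From Stdlib Require Import Rdefinitions Rpower.
From HB Require Import structures.
From mathcomp Require Import all_boot all_order all_algebra.
From mathcomp Require Import Rstruct.
From mathcomp Require Import zify ring lra.
Import Order.TTheory GRing.Theory Num.Theory.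
Set Implicit Arguments. Unset Strict Implicit. Unset Printing Implicit Defensive.
Local Open Scope ring_scope.

(** * Vertex cuts and balanced separators *)

(** Pigeonhole: the sets [F i] are disjoint, so their sizes add up to at most [#|X|] and one of them
    is at most average. This selects the cheapest of several candidate cuts. *)
Lemma small_class (I T : finType) (F : I -> {set T}) (X : {set T}) :
  (0 < #|I|)%N -> (forall i, F i \subset X) ->
  (forall i j x, x \in F i -> x \in F j -> i = j) ->
  exists i, (#|I| * #|F i| <= #|X|)%N.
Proof.
move=> I_gt0 sFX disjF.
have sumF : (\sum_i #|F i| <= #|X|)%N.
  under eq_bigr do rewrite -sum1_card.
  rewrite (exchange_big_dep (mem X)) /=; last by move=> i x _; apply: (subsetP (sFX i)).
  rewrite -[leqRHS]sum1_card; apply: leq_sum => x _; rewrite sum1_card.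
  apply/card_le1_eqP => i j xi xj; exact: (disjF j i x).
case: (boolP [exists i, (#|I| * #|F i| <= #|X|)%N]) => [/existsP //|].
move=> /existsPn large; exfalso.
have : (\sum_(i : I) #|X|.+1 <= \sum_(i : I) #|I| * #|F i|)%N.
  by apply: leq_sum => i _; rewrite ltnNge large.
rewrite sum_nat_const -big_distrr /= => le_sum.
have {}le_sum := leq_trans le_sum (leq_mul (leqnn #|I|) sumF).
by move: le_sum; rewrite leq_pmul2l // ltnn.
Qed.

Lemma popular_class (T I : finType) (f : T -> I) (Y : {set T}) :
  (0 < #|Y|)%N ->
  exists2 y0, y0 \in Y & (#|Y| <= #|I| * #|[set y in Y | f y == f y0]|)%N.
Proof.
move=> /card_gt0P [y1 y1Y].
pose m y0 := #|[set y in Y | f y == f y0]|.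
case: (@arg_maxnP T y1 (mem Y) m y1Y) => y0 y0Y max_y0.
exists y0 => //.
rewrite -[leqLHS]sum1_card (partition_big f predT) //=.
rewrite -sum_nat_const; apply: leq_sum => i _.
rewrite sum1dep_card.
case: (set_0Vmem [set y in Y | f y == i]) => [-> | [y]]; first by rewrite cards0.
by rewrite inE => /andP [yY /eqP <-]; apply: max_y0.
Qed.

(** The separator is implicit: it is [X :\: (A :|: B)]. *)
Definition vertex_cut (V : finType) (e : rel V) (X A B : {set V}) : Prop :=
  [/\ A \subset X, B \subset X, [disjoint A & B] &
      forall a b, a \in A -> b \in B -> ~~ e a b].

(** Each cut is charged to its smaller side, which is then set aside while cutting continues in the
    larger one. The charged sides are disjoint, so the total cost is at most [C * #|V|]. *)
Lemma separator_of_sparse_cuts (V : finType) (e : rel V) (J C : nat) :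
  symmetric e ->
  (forall X : {set V}, (2 * #|V| < 3 * #|X|)%N ->
     exists A B, [/\ vertex_cut e X A B, (0 < #|A|)%N, (0 < #|B|)%N,
       (J * #|X :\: (A :|: B)| <= C * #|A|)%N &
       (J * #|X :\: (A :|: B)| <= C * #|B|)%N]) ->
  exists S : {set V}, balanced_separator e S /\ (J * #|S| <= C * #|V|)%N.
Proof.
move=> e_sym cuts.
(* Components are replaced by sets [Y] closed under edges into [X :\: S]: such a set contains the
   component of [x] and is easier to carry through the induction. *)
pose good (X S : {set V}) := [/\ S \subset X, (J * #|S| <= C * #|X|)%N &
  forall x, x \in X :\: S -> exists Y : {set V},
    [/\ x \in Y, (3 * #|Y| <= 2 * #|V|)%N &
     forall y z, y \in Y -> z \in X :\: S -> e y z -> z \in Y]].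
have goodX n (X : {set V}) : (#|X| <= n)%N -> exists S, good X S.
  elim: n X => [|n IHn] X leXn.
    exists set0; split; rewrite ?sub0set ?cards0 ?muln0 // => x.
    have /eqP : #|X| == 0%N by lia.
    by move=> /cards0_eq ->; rewrite !inE.
  have [small|large] := leqP (3 * #|X|) (2 * #|V|).
    exists set0; split; rewrite ?sub0set ?cards0 ?muln0 // => x.
    rewrite setD0 => xX; exists X; split => // y z _; by rewrite setD0.
  have [A [B [cutAB A0 B0 SA SB]]] := cuts X large.
  wlog leAB : A B cutAB A0 B0 SA SB / (#|A| <= #|B|)%N.
    move=> IH; have [/IH|/ltnW/IH] := leqP #|A| #|B|; apply => //.
    - case: cutAB => sAX sBX dAB eAB; split; rewrite // 1?disjoint_sym // => a b aB bA.
      by rewrite e_sym eAB.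
    - by rewrite setUC.
    - by rewrite setUC.
  case: cutAB => sAX sBX dAB eAB.
  have cardX : #|X| = (#|A| + #|B| + #|X :\: (A :|: B)|)%N.
    have := cardsID (A :|: B) X; rewrite (setIidPr _) ?subUset ?sAX //.
    by rewrite cardsU disjoint_setI0 // cards0; lia.
  have [|T [sTB cardT T_good]] := IHn B; first lia.
  exists (X :\: (A :|: B) :|: T); split.
  - by rewrite subUset subsetDl (subset_trans sTB).
  - rewrite (leq_trans (leq_mul (leqnn J) (leq_card_setU _ _))) // cardX !mulnDr.
    by rewrite -[leqLHS]addn0 leq_add // leq_add.
  have inXS z : z \in X :\: (X :\: (A :|: B) :|: T) -> z \in A \/ z \in B :\: T.
    rewrite !inE; case: (z \in A); first by left.
    by case: (z \in B) (z \in T) (z \in X) => [] [] [] //=; right.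
  move=> x /inXS [xA|xB].
    exists A; split => // [|y z yA /inXS[//|]]; first (by have : (#|X| <= #|V|)%N := max_card _; lia).
    by rewrite inE => /andP[_ zB]; rewrite (negPf (eAB _ _ yA zB)).
  have [Y [xY cardY closY]] := T_good x xB.
  (* [Y] may contain vertices outside [B], whose neighbours are not controlled; the intersection
     discards them. *)
  exists (Y :&: B); split.
  - by rewrite inE xY; move: xB; rewrite inE => /andP[].
  - by have := subset_leq_card (subsetIl Y B); lia.
  move=> y z; rewrite inE => /andP[yY yB] /inXS [zA|zB] eyz.
    by move: eyz; rewrite e_sym (negPf (eAB _ _ zA yB)).
  by rewrite inE (closY y z) //; move: zB; rewrite inE => /andP[].
have [S [_ cardS closS]] := goodX _ [set: V] (leqnn _).
exists S; split; last by rewrite cardsT in cardS.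
move=> x xS; have [|Y [xY cardY closY]] := closS x; first by rewrite !inE xS.
have sub : [set y | connect (del_rel e S) x y] \subset Y.
  apply/subsetP => y; rewrite inE => /connectP [p].
  elim: p x xY {xS} => [|z p IHp] x xY /=; first by move=> _ ->.
  move=> /andP[/and3P[exz _ zS]]; apply: IHp.
  by apply: closY exz; rewrite // !inE zS.
have {}sub := subset_leq_card sub.
have : (3 * #|[set y | connect (del_rel e S) x y]| <= 2 * #|V|)%N by lia.
rewrite -(ler_nat R) !natrM; lra.
Qed.

Lemma Ktt_of_large (V : finType) (e : rel V) (t : nat) (A B : {set V}) :
  (t <= #|A|)%N -> (t <= #|B|)%N -> [disjoint A & B] ->
  (forall a b, a \in A -> b \in B -> e a b) -> contains_Ktt t e.
Proof.
move=> /card_geqP [a [a_uniq sz_a sub_a]] /card_geqP [b [b_uniq sz_b sub_b]] dAB eAB.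
exists [set x in a], [set x in b]; split; last split; last split.
- by rewrite cardsE (card_uniqP a_uniq).
- by rewrite cardsE (card_uniqP b_uniq).
- apply/pred0P => x; rewrite /= !inE; apply/negP => /andP[/sub_a xA /sub_b xB].
  by rewrite (disjointFr dAB xA) in xB.
by move=> x y; rewrite !inE => /sub_a xA /sub_b; apply: eAB.
Qed.

Lemma clique_card (V : finType) (e : rel V) (t : nat) (M : {set V}) :
  ~ contains_Ktt t e ->
  (forall u v, u \in M -> v \in M -> u != v -> e u v) -> (#|M| <= 2 * t)%N.
Proof.
move=> noK clique; rewrite leqNgt; apply/negP => big_M; apply: noK.
have /card_geqP [a [a_uniq sz_a sub_a]] : (t <= #|M|)%N by lia.
have sAM : [set x in a] \subset M by apply/subsetP => x; rewrite inE => /sub_a.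
have card_a : #|[set x in a]| = t by rewrite cardsE (card_uniqP a_uniq).
apply: (@Ktt_of_large _ _ _ [set x in a] (M :\: [set x in a])); rewrite ?card_a //.
- by rewrite cardsD (setIidPr sAM) card_a; lia.
- by rewrite -setI_eq0 setDE setICA setICr setI0.
move=> x y xa /setDP[yM ya]; apply: clique => //; first exact: (subsetP sAM).
by apply: contraNneq ya => <-.
Qed.

(** * Long chains of nested spheres *)

(** Distances between centres; distinct spheres may be concentric, hence no separation axiom. *)
Definition pseudometric (V : Type) (D : V -> V -> R) : Prop :=
  [/\ forall u, D u u = 0, forall u v, D u v = D v u &
      forall u v w, D u w <= D u v + D v w].

Definition meets (V : Type) (D : V -> V -> R) (r : V -> R) (u v : V) : bool :=
  `|r u - r v| <= D u v <= r u + r v.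

(** Strict, because internally tangent spheres count as meeting. *)
Definition nested (V : Type) (D : V -> V -> R) (r : V -> R) (u v : V) : bool :=
  D u v < r v - r u.

Lemma meetsP (V : Type) (D : V -> V -> R) (r : V -> R) u v :
  reflect [/\ r u - r v <= D u v, r v - r u <= D u v & D u v <= r u + r v]
          (meets D r u v).
Proof.
rewrite /meets ler_norml; apply: (iffP idP) => [/andP[/andP[h1 h2] h3]|[h1 h2 h3]].
  by split => //; lra.
by rewrite h1 h3 !andbT; lra.
Qed.

Lemma pseudometric_ge0 (V : Type) (D : V -> V -> R) u v : pseudometric D -> 0 <= D u v.
Proof. by case=> D0 DC DT; have := DT u v u; rewrite D0 (DC v u); lra. Qed.

Lemma meetsC (V : Type) (D : V -> V -> R) (r : V -> R) u v :
  pseudometric D -> meets D r u v = meets D r v u.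
Proof. by case=> _ DC _; rewrite /meets distrC DC [r u + _]addrC. Qed.

Lemma nested_trans (V : Type) (D : V -> V -> R) (r : V -> R) :
  pseudometric D -> transitive (nested D r).
Proof. by case=> _ _ DT v u w; rewrite /nested; have := DT u v w; lra. Qed.

(* A connected sphere meeting both the inner and the outer of three nested spheres
   must cross the one in between. *)
Lemma meets_between (V : Type) (D : V -> V -> R) (r : V -> R) x u v w :
  pseudometric D -> nested D r u v -> nested D r v w ->
  meets D r x u -> meets D r x w -> meets D r x v.
Proof.
move=> [_ DC DT]; rewrite /nested => uv vw /meetsP[a1 a2 a3] /meetsP[b1 b2 b3].
apply/meetsP; have := DT x v u; have := DT x v w; have := DT x u v.
by rewrite (DC v u); split; lra.
Qed.

Lemma nested_not_meets (V : Type) (D : V -> V -> R) (r : V -> R) u v :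
  pseudometric D -> nested D r u v -> ~~ meets D r u v.
Proof. by move=> [_ DC DT]; rewrite /nested => uv; apply/negP => /meetsP[? ? ?]; lra. Qed.

Lemma nested_or_meets (V : Type) (D : V -> V -> R) (r : V -> R) u v :
  pseudometric D -> D u v <= r u + r v ->
  ~~ nested D r u v -> ~~ nested D r v u -> meets D r u v.
Proof.
by move=> [_ DC _]; rewrite /nested (DC v u) -!leNgt => *; apply/meetsP; split.
Qed.

(** Mirsky's argument: the minimal spheres [M] of [P] are pairwise not nested, so they meet and
    number at most [w]. A chain in [P :\: M] starts at a non-minimal sphere and can therefore be
    prolonged downwards, so each layer adds one element. *)
Lemma long_nested_chain (V : finType) (D : V -> V -> R) (r : V -> R) (w : nat)
    (P : {set V}) :
  pseudometric D ->
  (forall u v, u \in P -> v \in P -> D u v <= r u + r v) ->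
  (forall M : {set V}, M \subset P ->
     (forall u v, u \in M -> v \in M -> u != v -> meets D r u v) -> (#|M| <= w)%N) ->
  exists s : seq V, [/\ sorted (nested D r) s, {subset s <= P} &
                        (#|P| <= w * size s)%N].
Proof.
move=> pmD; have [n] := ubnP #|P|; elim: n P => // n IHn P ltPn touching small.
have [->|[p0 p0P]] := set_0Vmem P.
  by exists [::]; rewrite cards0.
pose M := [set u in P | [forall v in P, ~~ nested D r v u]].
have sMP : M \subset P by apply/subsetP => u; rewrite inE => /andP[].
have cardM : (#|M| <= w)%N.
  apply: small => // u v; rewrite !inE => /andP[uP /forall_inP minu] /andP[vP /forall_inP minv] _.
  by apply: nested_or_meets; rewrite ?touching ?minu ?minv.
(* A sphere of least radius is minimal, so the induction makes progress. *)
have [u0 u0M] : exists u, u \in M.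
  case: (@arg_minP _ _ _ p0 (mem P) r p0P) => u uP minr; exists u.
  rewrite inE; apply/andP; split => //; apply/forall_inP => v vP.
  rewrite /nested -leNgt; have := minr v vP; have := pseudometric_ge0 v u pmD; lra.
have cardP : #|P| = (#|M| + #|P :\: M|)%N by rewrite -(cardsID M P) (setIidPr sMP).
have M0 : (0 < #|M|)%N by apply/card_gt0P; exists u0.
have [|||s [s_sorted s_sub s_size]] := IHn (P :\: M).
- lia.
- by move=> u v /setDP[uP _] /setDP[vP _]; apply: touching.
- by move=> N sN; apply: small; rewrite (subset_trans sN) ?subsetDl.
(* An empty chain forces [P :\: M] to be empty; one sphere of [M] then suffices. *)
case: s => [|q s] in s_sorted s_sub s_size.
  exists [:: u0]; split => //; last by move: s_size => /=; lia.
  by move=> u; rewrite inE => /eqP ->; apply: (subsetP sMP).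
have /setDP[qP] : q \in P :\: M by apply: s_sub; rewrite mem_head.
rewrite inE qP /= => /forall_inPn [p pP]; rewrite negbK => pq.
exists [:: p, q & s]; split => [|u|].
- by rewrite /= pq.
- by rewrite inE => /predU1P[->//|/s_sub /setDP[]].
- by rewrite /= mulnS cardP leq_add.
Qed.

(** By the triangle inequality, a sphere that meets one lying inside [v] either lies inside [v] or
    meets [v] itself. Hence the spheres meeting [v] separate the inside from the rest. *)
Lemma nested_chain_cut (V : finType) (e : rel V) (D : V -> V -> R) (r : V -> R)
    (X : {set V}) (v : V) :
  pseudometric D -> (forall x y, x != y -> e x y = meets D r x y) ->
  let A := [set x in X | nested D r x v] in
  let B := X :\: (A :|: [set x in X | meets D r x v]) in
  vertex_cut e X A B /\ X :\: (A :|: B) = [set x in X | meets D r x v].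
Proof.
move=> pmD e_meets A B.
have AS x : x \in A -> ~~ meets D r x v.
  by rewrite inE => /andP[_]; apply: nested_not_meets.
split; last first.
  apply/setP => x; move: (AS x); rewrite !inE; case: (x \in X) => //=.
  by case: nested => //= [/(_ isT)/negPf ->//|]; case: meets.
split.
- by apply/subsetP => x; rewrite inE => /andP[].
- by rewrite subsetDl.
- by rewrite -setI_eq0; apply/eqP/setP => x; rewrite !inE; case: (x \in X); case: nested; rewrite ?andbF.
move=> a b aA bB; have ab : a != b.
  by apply: contraTneq bB => <-; rewrite inE in_setU aA.
rewrite e_meets //; move: aA bB; rewrite !inE => /andP[_ av] /andP[+ bX].
rewrite bX /= negb_or => /andP[nbv mbv]; apply/negP => /meetsP [h1 h2 h3].
move: pmD av nbv mbv => [_ DC DT]; rewrite /nested -leNgt => av nbv /meetsP; apply.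
by have := DT a v b; have := DT b a v; rewrite (DC b a) (DC v b); split; lra.
Qed.

(* Cut along one sphere [v] of a long nested chain.  Taking candidates for [v] at
   distance [t] along the chain, a sphere crossing two consecutive candidates crosses
   all [t] spheres between them, so fewer than [t] do; as each sphere crosses a
   contiguous part of the chain, it is newly met by only one candidate. *)
Lemma touching_cut (V : finType) (e : rel V) (D : V -> V -> R) (r : V -> R)
    (t q : nat) (X P : {set V}) :
  pseudometric D -> (forall x y, x != y -> e x y = meets D r x y) ->
  ~ contains_Ktt t e -> (0 < t)%N -> (0 < q)%N -> P \subset X ->
  (forall u v, u \in P -> v \in P -> D u v <= r u + r v) ->
  (2 * t * (3 * t * q).+1 <= #|P|)%N ->
  exists A B, [/\ vertex_cut e X A B, (q * t <= #|A|)%N, (q * t <= #|B|)%N &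
                  (q * #|X :\: (A :|: B)| <= #|X| + q * t)%N].
Proof.
move=> pmD e_meets noK t_gt0 q_gt0 sPX touching bigP.
have [|s [s_sorted s_sub s_size]] := @long_nested_chain V D r (2 * t) P pmD touching.
  move=> M _ clique; apply: clique_card noK _ => u v uM vM uv.
  by rewrite e_meets // clique.
have {s_size} s_size : (3 * t * q < size s)%N.
  by rewrite -(@leq_pmul2l (2 * t)) ?muln_gt0 // (leq_trans bigP).
have [x0 _] : exists x0, x0 \in P by apply/card_gt0P; lia.
pose u j := nth x0 s j.
have uX j : (j < size s)%N -> u j \in X.
  by move=> lt_j; apply: (subsetP sPX); apply: s_sub; apply: mem_nth.
have u_nested i j : (i < j)%N -> (j < size s)%N -> nested D r (u i) (u j).
  move=> lt_ij lt_j; apply: (sorted_ltn_nth (nested_trans pmD)); rewrite ?inE //.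
  exact: ltn_trans lt_j.
have not_nested x : ~~ nested D r x x.
  by case: pmD => D0 _ _; rewrite /nested D0 subrr ltxx.
have not_meets i j : (i < j)%N -> (j < size s)%N -> ~~ meets D r (u i) (u j).
  by move=> lt_ij lt_j; apply: nested_not_meets => //; apply: u_nested.
have card_block m n : (m + n <= size s)%N -> #|[set x in map u (iota m n)]| = n.
  move=> le_mn; rewrite cardsE (card_uniqP _) ?size_map ?size_iota //.
  rewrite map_inj_in_uniq ?iota_uniq // => i j; rewrite !mem_iota => lt_i lt_j uij.
  have [lt|lt|//] := ltngtP i j.
    by have := u_nested i j lt; rewrite uij (negPf (not_nested _)) => /(_ ltac:(lia)).
  by have := u_nested j i lt; rewrite uij (negPf (not_nested _)) => /(_ ltac:(lia)).
have inblock m n x : x \in [set x in map u (iota m n)] ->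
    exists2 j, (m <= j < m + n)%N & x = u j.
  by rewrite inE => /mapP [j]; rewrite mem_iota; exists j.
have between x i j k : (i <= j <= k)%N -> (k < size s)%N ->
    meets D r x (u i) -> meets D r x (u k) -> meets D r x (u j).
  case/andP; rewrite leq_eqVlt => /predU1P[-> //|lt_ij].
  rewrite leq_eqVlt => /predU1P[-> //|lt_jk] lt_k.
  by apply: meets_between => //; apply: u_nested => //; apply: ltn_trans lt_k.
(* The candidates occupy positions from [q * t] to [2 * q * t]; as the chain has more than
   [3 * t * q] members, at least [q * t] of them remain on either side of each candidate. *)
pose pos i := (q * t + i * t)%N.
have pos_lt i : (i <= q)%N -> (pos i + q * t < size s)%N.
  by move=> le_i; apply: leq_ltn_trans s_size; rewrite /pos; nia.
have pos_mono i j : (i <= j)%N -> (pos i <= pos j)%N.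
  by move=> le_ij; rewrite leq_add2l leq_mul2r le_ij orbT.
pose S i := [set x in X | meets D r x (u (pos i))].
have [i Fi] : exists i : 'I_q, (#|'I_q| * #|S i.+1 :\: S i| <= #|X|)%N.
  apply: small_class => [|i|]; first by rewrite card_ord.
    by apply/subsetP => x; rewrite !inE => /and3P[].
  have disj i j x : (i < j)%N -> (j < q)%N ->
      x \in S i.+1 :\: S i -> x \in S j.+1 :\: S j -> False.
    move=> lt_ij lt_j; rewrite !inE => /and3P[_ xX xi] /and3P[+ _ xj].
    rewrite xX /= => /negP; apply; apply: between xi xj.
      by rewrite !pos_mono.
    by have := pos_lt j.+1 lt_j; lia.
  move=> i j x xi xj; apply: val_inj; have [lt|lt|//] := ltngtP (val i) (val j).
    by case: (disj i j x).
  by case: (disj j i x).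
have lt_pos : (pos i.+1 + q * t < size s)%N by apply: pos_lt.
have posS : pos i.+1 = (pos i + t)%N by rewrite /pos; lia.
have Gi : (#|S i.+1 :&: S i| < t)%N.
  rewrite ltnNge; apply/negP => big; apply: noK.
  have adj x y : x \in S i.+1 :&: S i -> y \in [set x in map u (iota (pos i) t)] ->
      x != y /\ meets D r x y.
    move=> xS /inblock [j lt_j ->].
    move: xS; rewrite !inE => /andP[/andP[_ x1] /andP[_ x2]].
    split; last by apply: between x2 x1; lia.
    (* [x] meets the sphere at [pos i.+1], which no sphere of the block does, so [x] is not in the
       block. *)
    by apply: contraTneq x1 => ->; apply: not_meets; lia.
  apply: (Ktt_of_large (B := [set x in map u (iota (pos i) t)]) big).
  - by rewrite card_block; lia.
  - apply/pred0P => x /=; apply/negP => /andP[xS xu].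
    by have [] := adj x x xS xu; rewrite eqxx.
  - by move=> x y /adj H /H [xy mxy]; rewrite e_meets.
have [cut sep] := @nested_chain_cut V e D r X (u (pos i.+1)) pmD e_meets.
exists [set x in X | nested D r x (u (pos i.+1))].
set A := [set x in X | _] in cut sep *; exists (X :\: (A :|: S i.+1)).
have card_pos : (q * t <= pos i.+1)%N by rewrite leq_addr.
split => //.
- rewrite -[leqLHS](@card_block 0 (q * t)); last by lia.
  apply/subset_leq_card/subsetP => x /inblock [j lt_j ->].
  by rewrite inE uX ?u_nested //; lia.
- rewrite -[leqLHS](@card_block (pos i.+1).+1 (q * t)); last by lia.
  apply/subset_leq_card/subsetP => x /inblock [j lt_j ->].
  rewrite !inE uX /=; last by lia.
  rewrite andbT negb_or meetsC // not_meets ?andbT; try lia.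
  have nj := u_nested (pos i.+1) j ltac:(lia) ltac:(lia).
  by apply/negP => /(nested_trans pmD nj); apply/negP.
rewrite sep -/(S i.+1) -(cardsID (S i)) mulnDr addnC leq_add //.
  by move: Fi; rewrite card_ord.
by rewrite leq_mul2l (ltnW Gi) orbT.
Qed.

(** * Cuts from Euclidean geometry *)

Definition dist (d : nat) (x y : 'rV[R]_d) : R := Num.sqrt (dist2 x y).

Lemma dist2_ge0 (d : nat) (x y : 'rV[R]_d) : 0 <= dist2 x y.
Proof. by apply: sumr_ge0 => i _; apply: sqr_ge0. Qed.

Lemma dist_ge0 (d : nat) (x y : 'rV[R]_d) : 0 <= dist x y.
Proof. exact: sqrtr_ge0. Qed.

Lemma sqr_dist (d : nat) (x y : 'rV[R]_d) : dist x y ^+ 2 = dist2 x y.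
Proof. by rewrite sqr_sqrtr ?dist2_ge0. Qed.

Lemma sum_CauchySchwarz (I : finType) (a b : I -> R) :
  (\sum_i a i * b i) ^+ 2 <= (\sum_i a i ^+ 2) * (\sum_i b i ^+ 2).
Proof.
set P := \sum_i a i * b i; set A := \sum_i a i ^+ 2; set B := \sum_i b i ^+ 2.
have B_ge0 : 0 <= B by apply: sumr_ge0 => i _; apply: sqr_ge0.
have [B0|B_neq0] := eqVneq B 0.
  have b0 i : b i = 0.
    have := @psumr_eq0P _ _ predT (fun i => b i ^+ 2) (fun i _ => sqr_ge0 _) B0 i isT.
    by move/eqP; rewrite sqrf_eq0 => /eqP.
  by rewrite B0 mulr0 /P big1 ?expr0n // => i _; rewrite b0 mulr0.
have : 0 <= \sum_i (B * a i - P * b i) ^+ 2.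
  by apply: sumr_ge0 => i _; apply: sqr_ge0.
have -> : \sum_i (B * a i - P * b i) ^+ 2 = B * (A * B - P ^+ 2).
  transitivity (\sum_i (B ^+ 2 * a i ^+ 2 - 2 * B * P * (a i * b i) + P ^+ 2 * b i ^+ 2)).
    by apply: eq_bigr => i _; ring.
  rewrite big_split sumrB /= -!big_distrr /= -/A -/B -/P; ring.
by rewrite pmulr_rge0 ?subr_ge0 // lt_neqAle eq_sym B_neq0.
Qed.

Lemma dist_triangle (d : nat) (x y z : 'rV[R]_d) : dist x z <= dist x y + dist y z.
Proof.
have s_ge0 : 0 <= dist x y + dist y z by rewrite addr_ge0 ?dist_ge0.
rewrite -(@ler_pXn2r _ 2) ?nnegrE ?dist_ge0 // sqrrD !sqr_dist.
set P := \sum_i (x ord0 i - y ord0 i) * (y ord0 i - z ord0 i).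
have -> : dist2 x z = dist2 x y + P *+ 2 + dist2 y z.
  rewrite /dist2 /P -sumrMnl -!big_split /=; apply: eq_bigr => i _; ring.
rewrite lerD2r lerD2l lerMn2r /=.
have [P_lt0|P_ge0] := ltP P 0.
  by rewrite (le_trans (ltW P_lt0)) // mulr_ge0 ?dist_ge0.
rewrite -(@ler_pXn2r _ 2) ?nnegrE ?mulr_ge0 ?dist_ge0 // exprMn !sqr_dist.
exact: sum_CauchySchwarz.
Qed.

Lemma dist_pseudometric (V : Type) (d : nat) (c : V -> 'rV[R]_d) :
  pseudometric (fun u v => dist (c u) (c v)).
Proof.
split=> [u|u v|u v w].
- by rewrite /dist /dist2 big1 ?sqrtr0 // => i _; rewrite subrr expr0n.
- by congr Num.sqrt; apply: eq_bigr => i _; rewrite -sqrrN opprB.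
- exact: dist_triangle.
Qed.

Lemma distC (d : nat) (x y : 'rV[R]_d) : dist x y = dist y x.
Proof. by case: (@dist_pseudometric _ d id) => _ + _; apply. Qed.

Lemma distxx (d : nat) (x : 'rV[R]_d) : dist x x = 0.
Proof. by case: (@dist_pseudometric _ d id) => + _ _; apply. Qed.

Lemma coord_dist (d : nat) (x y : 'rV[R]_d) i : `|x ord0 i - y ord0 i| <= dist x y.
Proof.
rewrite -sqrtr_sqr ler_wsqrtr // /dist2 (bigD1 i) //= lerDl.
by apply: sumr_ge0 => j _; apply: sqr_ge0.
Qed.

Lemma dist2_line (d : nat) (x y : 'rV[R]_d) (s t : R) :
  dist2 (x + s *: (y - x)) (x + t *: (y - x)) = (s - t) ^+ 2 * dist2 y x.
Proof.
by rewrite /dist2 big_distrr /=; apply: eq_bigr => i _; rewrite !mxE; ring.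
Qed.

Lemma dist_line (d : nat) (x y : 'rV[R]_d) (s t : R) :
  dist (x + s *: (y - x)) (x + t *: (y - x)) = `|s - t| * dist y x.
Proof. by rewrite /dist dist2_line sqrtrM ?sqr_ge0 // sqrtr_sqr. Qed.

(** The coordinates, which range over intervals of length [2 * rho], are rounded to slots of width
    [eps / d]. This gives at most [K ^ d] cells of diameter at most [eps], and a fullest cell is
    taken. *)
Lemma crowded_cell (d : nat) (T : finType) (Y : {set T}) (z : T -> 'rV[R]_d)
    (x0 : 'rV[R]_d) (rho eps : R) (K : nat) :
  0 < eps -> (forall y, y \in Y -> dist (z y) x0 <= rho) ->
  2 * rho * d%:R < eps * K%:R -> (0 < #|Y|)%N ->
  exists2 y0, y0 \in Y &
    (#|Y| <= K ^ d * #|[set y in Y | (dist (z y0) (z y) <= eps)%R]|)%N.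
Proof.
move=> eps_gt0 Yrho big_K Y_gt0.
have [y1 y1Y] := card_gt0P Y_gt0.
have rho_ge0 : 0 <= rho by rewrite (le_trans (dist_ge0 _ _) (Yrho y1 y1Y)).
case: K big_K => [|K] big_K.
  by move: big_K; rewrite mulr0 ltNge !mulr_ge0.
pose g y i := (z y ord0 i - x0 ord0 i + rho) * d%:R / eps.
have g_itv y i : y \in Y -> 0 <= g y i < K.+1%:R.
  move=> yY; have := le_trans (coord_dist (z y) x0 i) (Yrho y yY).
  rewrite ler_norml => /andP[lo hi].
  rewrite /g ltr_pdivrMr // divr_ge0 ?mulr_ge0 ?(ltW eps_gt0) //=; last by lra.
  rewrite (le_lt_trans _ (lt_le_trans big_K _)) //; last by rewrite mulrC.
  by rewrite ler_wpM2r //; lra.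
(* [inord] has a default value out of range, but [g_itv] keeps every point of [Y] in range. *)
pose f y := [ffun i : 'I_d => inord (Num.truncn (g y i)) : 'I_K.+1].
have [y0 y0Y cardY] := popular_class f Y_gt0; exists y0 => //.
rewrite card_ffun !card_ord in cardY; apply: (leq_trans cardY).
rewrite leq_mul2l subset_leq_card ?orbT //; apply/subsetP => y.
rewrite !inE => /andP[yY /eqP/ffunP eq_f]; rewrite yY /=.
have close i : `|(z y0 ord0 i - z y ord0 i) * d%:R| <= eps.
  have /andP[g0 gK] := g_itv y i yY; have /andP[g0' gK'] := g_itv y0 i y0Y.
  have := eq_f i; rewrite !ffunE => /(congr1 val); rewrite /= !inordK; last first.
  - by rewrite truncn_lt_nat.
  - by rewrite truncn_lt_nat.
  have /andP[] := truncn_itv g0; have /andP[] := truncn_itv g0'.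
  move=> + + + + eq_t; rewrite eq_t -natr1 => a1 a2 a3 a4.
  have -> : (z y0 ord0 i - z y ord0 i) * d%:R = (g y0 i - g y i) * eps.
    by rewrite /g; field; rewrite gt_eqF.
  rewrite normrM (gtr0_norm eps_gt0) ger_pMl // ler_norml; apply/andP; split; lra.
rewrite -(@ler_pXn2r _ 2) ?nnegrE ?dist_ge0 ?(ltW eps_gt0) // sqr_dist.
have [d0|d_gt0] := posnP d.
  by subst d; rewrite /dist2 big_ord0 sqr_ge0.
have d_ge1 : 1 <= d%:R :> R by rewrite ler1n.
have : d%:R ^+ 2 * dist2 (z y0) (z y) <= d%:R * eps ^+ 2.
  rewrite /dist2 big_distrr /=.
  apply: (@le_trans _ _ (\sum_(i < d) eps ^+ 2)); last by rewrite sumr_const card_ord mulr_natl.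
  apply: ler_sum => i _; rewrite -exprMn mulrC -ler_sqrt ?sqr_ge0 // !sqrtr_sqr.
  by rewrite (le_trans (close i)) ?ler_norm.
rewrite expr2 -mulrA ler_pM2l ?ltr0n //; apply: le_trans.
by rewrite ler_peMl ?dist2_ge0.
Qed.

(** Each ball contains a ball of radius [eps] whose centre [z v] is within [rho + eps] of [x0].
    Balls whose points [z v] are within [eps] of [z y0] all contain [z y0], so any two of them
    intersect. *)
Lemma touching_of_large (V : finType) (d : nat) (c : V -> 'rV[R]_d) (r : V -> R)
    (L : {set V}) (x0 : 'rV[R]_d) (rho eps : R) (K : nat) :
  0 < eps -> 0 <= rho -> 2 * (rho + eps) * d%:R < eps * K%:R ->
  (forall v, v \in L -> eps <= r v /\ dist (c v) x0 <= r v + rho) ->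
  exists P : {set V}, [/\ P \subset L,
    forall u v, u \in P -> v \in P -> dist (c u) (c v) <= r u + r v &
    (#|L| <= K ^ d * #|P|)%N].
Proof.
move=> eps_gt0 rho_ge0 big_K large.
have [->|/set0Pn [v1 v1L]] := eqVneq L set0.
  by exists set0; split; rewrite ?cards0 // => u v; rewrite inE.
(* A centre beyond distance [rho + eps] is pulled radially back to that distance, a move of at most
   [r v - eps]. *)
pose k v := if dist (c v) x0 <= rho + eps then 1 else (rho + eps) / dist (c v) x0.
pose z v := x0 + k v *: (c v - x0).
have z_c v : v \in L -> dist (z v) x0 <= rho + eps /\ dist (z v) (c v) <= r v - eps.
  move=> vL; have [le_eps le_rho] := large v vL.
  have := dist_line x0 (c v) (k v) 0; rewrite scale0r addr0 subr0 => ->.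
  have := dist_line x0 (c v) (k v) 1; rewrite scale1r [x0 + (_ - _)]addrC subrK => ->.
  rewrite /k; case: ifPn => [le_d|].
    by rewrite normr1 mul1r subrr normr0 mul0r subr_ge0.
  rewrite -ltNge => lt_d; have d_gt0 : 0 < dist (c v) x0 by lra.
  rewrite ger0_norm ?divr_ge0 //; try lra.
  rewrite distrC ger0_norm ?subr_ge0 ?ler_pdivrMr ?mul1r ?(ltW lt_d) //.
  rewrite mulrBl divfK ?gt_eqF // mul1r; split; lra.
have L_gt0 : (0 < #|L|)%N by apply/card_gt0P; exists v1.
have z_x0 v : v \in L -> dist (z v) x0 <= rho + eps by move/z_c => [].
have [y0 y0L cardL] := crowded_cell eps_gt0 z_x0 big_K L_gt0.
exists [set y in L | dist (z y0) (z y) <= eps]; split => //.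
  by apply/subsetP => y; rewrite inE => /andP[].
have z0_c u : u \in [set y in L | dist (z y0) (z y) <= eps] -> dist (z y0) (c u) <= r u.
  rewrite inE => /andP[/z_c[_ zu] z0u]; have := dist_triangle (z y0) (z u) (c u); lra.
move=> u v /z0_c zu /z0_c zv; have := dist_triangle (c u) (z y0) (c v).
rewrite (distC (c u) (z y0)); lra.
Qed.

(* Spheres of radius comparable to the scale [R0] of the smallest ball about a centre
   holding a fixed fraction of the centres are either so numerous that many of them
   share a point, or few enough to be deleted; the remaining small ones are cut by the
   best of [J] concentric spheres with radii in [[R0, 3 R0]]. *)
Lemma geometric_cut (V : finType) (e : rel V) (d : nat) (c : V -> 'rV[R]_d)
    (r : V -> R) (X : {set V}) (J : nat) :
  let kappa := (2 * (13 * d) ^ d)%N in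
  (0 < d)%N -> (4 * kappa <= J)%N -> (0 < #|X|)%N -> (forall v, 0 <= r v) ->
  (forall x y, x != y -> e x y = meets (fun u v => dist (c u) (c v)) r x y) ->
  (exists P : {set V}, [/\ P \subset X,
     forall u v, u \in P -> v \in P -> dist (c u) (c v) <= r u + r v &
     (#|X| <= J * (8 * d * J) ^ d * #|P|)%N]) \/
  (exists A B, [/\ vertex_cut e X A B, (#|X| <= 2 * kappa * #|A|)%N,
     (#|X| <= 2 * kappa * #|B|)%N & (J * #|X :\: (A :|: B)| <= 2 * #|X|)%N]).
Proof.
move=> kappa d_gt0 big_J X_gt0 r_ge0 e_meets.
have kappa_ge2 : (2 <= kappa)%N by rewrite -[leqLHS]muln1 leq_mul2l expn_gt0 muln_gt0 d_gt0.
have J_gt0 : (0 < J)%N by lia.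
have [v1 v1X] := card_gt0P X_gt0.
pose cluster v w := [set x in X | dist (c v) (c x) <= dist (c v) (c w)].
(* Radii are restricted to distances between a centre and some vertex's centre, so the least radius
   of a heavy ball is a minimum over a finite set. *)
pose heavy vw := (vw.1 \in X) && (#|X| <= kappa * #|cluster vw.1 vw.2|)%N.
have farthest v (Y : {set V}) x : x \in Y -> Y \subset X ->
    exists2 w, w \in Y & Y \subset cluster v w.
  move=> xY sYX.
  case: (@arg_maxP _ _ _ x (mem Y) (fun y => dist (c v) (c y)) xY) => w wY maxw.
  exists w => //; apply/subsetP => y yY; rewrite inE (subsetP sYX) //=.
  exact: maxw.
have [w1 w1_heavy] : exists w, heavy (v1, w).
  have [w _ sXw] := farthest v1 X v1 v1X (subxx X); exists w.
  rewrite /heavy v1X /= (leq_trans (subset_leq_card sXw)) // leq_pmull //; lia.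
case: (@arg_minP _ _ _ (v1, w1) heavy (fun vw => dist (c vw.1) (c vw.2)) w1_heavy).
case=> v w /= /andP[/= vX vw_heavy] min_vw.
set R0 := dist (c v) (c w) in min_vw.
have R0_ge0 : 0 <= R0 := dist_ge0 _ _.
(* At scale zero, a fixed fraction of the spheres are concentric, so their balls share a point. *)
have [R0_le0|R0_gt0] := leP R0 0.
  left; exists (cluster v w); split.
  - by apply/subsetP => x; rewrite inE => /andP[].
  - move=> x y; rewrite !inE -/R0 => /andP[_ xv] /andP[_ yv].
    have := dist_triangle (c x) (c v) (c y); rewrite (distC (c x) (c v)).
    have := r_ge0 x; have := r_ge0 y; lra.
  - rewrite (leq_trans vw_heavy) // leq_mul2r; apply/orP; right.
    by rewrite -[kappa]muln1 leq_mul ?expn_gt0 ?muln_gt0 ?d_gt0 ?J_gt0 //; lia.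
pose near := [set x in X | dist (c v) (c x) <= 3 * R0].
(* Otherwise a cell of size [R0 / 2] holds enough centres to be heavy, against the minimality of
   [R0]. Covering radius [3 * R0] needs more than [12 * d] slots per coordinate, whence [13 * d] in
   [kappa]; its factor 2 comes from the half. *)
have near_half : (2 * #|near| <= #|X|)%N.
  rewrite leqNgt; apply/negP => big_near.
  have near_x0 y : y \in near -> dist (c y) (c v) <= 3 * R0.
    by rewrite inE distC => /andP[].
  have half_gt0 : 0 < R0 / 2 by lra.
  have big_K : 2 * (3 * R0) * d%:R < R0 / 2 * (13 * d)%:R.
    have : 0 < R0 * d%:R by rewrite mulr_gt0 ?ltr0n.
    rewrite natrM; lra.
  have near_gt0 : (0 < #|near|)%N by lia.
  have [y0 y0near card_near] := crowded_cell half_gt0 near_x0 big_K near_gt0.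
  set Y := [set y in near | _] in card_near.
  have y0Y : y0 \in Y by rewrite inE y0near distxx /=; lra.
  have sYX : Y \subset X.
    by apply/subsetP => y; rewrite !inE => /andP[/andP[]].
  have [w0 w0Y sYw0] := farthest y0 Y y0 y0Y sYX.
  have y0w0_heavy : heavy (y0, w0).
    rewrite /heavy (subsetP sYX) //= (leq_trans (ltnW big_near)) //.
    rewrite /kappa -mulnA leq_mul2l /= (leq_trans card_near) //.
    by rewrite leq_mul2l subset_leq_card ?orbT.
  have := min_vw _ y0w0_heavy; rewrite /=; move: w0Y; rewrite inE => /andP[_]; lra.
have eps_gt0 : 0 < R0 / J%:R by rewrite divr_gt0 ?ltr0n.
set eps := R0 / J%:R in eps_gt0.
have epsJ : eps * J%:R = R0 by rewrite divfK // pnatr_eq0; lia.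
have J_ge1 : 1 <= J%:R :> R by rewrite ler1n.
pose L := [set x in X | (eps <= r x) && (dist (c x) (c v) <= r x + 3 * R0)].
have [L_big|L_small] := leqP #|X| (J * #|L|).
  have rho_ge0 : 0 <= 3 * R0 by lra.
  have big_K : 2 * (3 * R0 + eps) * d%:R < eps * (8 * d * J)%:R.
    have eps_le : 2 * eps <= R0.
      by rewrite -epsJ mulrC ler_wpM2l ?(ltW eps_gt0) // ler_nat; lia.
    rewrite !natrM (_ : eps * _ = 8 * R0 * d%:R); last by rewrite -epsJ; ring.
    have : 0 < R0 * d%:R by rewrite mulr_gt0 ?ltr0n.
    have : 2 * eps * d%:R <= R0 * d%:R by rewrite ler_wpM2r.
    lra.
  have largeL x : x \in L -> eps <= r x /\ dist (c x) (c v) <= r x + 3 * R0.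
    by rewrite inE => /and3P[].
  have [P [sPL touching cardL]] := touching_of_large eps_gt0 rho_ge0 big_K largeL.
  left; exists P; split => //.
    by apply: subset_trans sPL _; apply/subsetP => x; rewrite inE => /andP[].
  by rewrite (leq_trans L_big) // -mulnA leq_mul2l cardL orbT.
right.
(* The radii are [2 * eps] apart, so a sphere of radius below [eps] crosses at most one of the [J]
   concentric spheres. *)
pose s (j : 'I_J) := R0 + (2 * j + 1)%:R * eps.
pose Z j := [set x in X | (r x < eps) && (`|dist (c x) (c v) - s j| <= r x)].
have [j Zj] : exists j, (#|'I_J| * #|Z j| <= #|X|)%N.
  apply: small_class => [|j|]; first by rewrite card_ord.
    by apply/subsetP => x; rewrite inE => /andP[].
  have disj (i j : 'I_J) x : (i < j)%N -> x \in Z i -> x \in Z j -> False.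
    rewrite -(ler_nat R) -natr1 !inE => lt_ij /and3P[_ x_small +] /and3P[_ _].
    rewrite !ler_norml => /andP[i1 i2] /andP[j1 j2].
    have : s i + 2 * eps <= s j.
      rewrite /s -addrA lerD2l -mulrDl ler_wpM2r ?(ltW eps_gt0) //.
      by rewrite (natrD _ (2 * i)) (natrD _ (2 * j)) !natrM; lra.
    lra.
  move=> i j x xi xj; apply: val_inj; have [lt|lt|//] := ltngtP (val i) (val j).
    by case: (disj i j x).
  by case: (disj j i x).
rewrite card_ord in Zj.
have s_gt : R0 < s j by rewrite ltrDl mulr_gt0 // ltr0n addn1.
have s_le : s j <= 3 * R0.
  have : (2 * j + 1)%:R <= (2 * J)%:R :> R by rewrite ler_nat; have := ltn_ord j; lia.
  rewrite natrM => h; rewrite /s; have := ler_wpM2r (ltW eps_gt0) h.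
  rewrite (_ : 2 * J%:R * eps = 2 * R0); last by rewrite -epsJ; ring.
  lra.
pose A := [set x in X | (r x < eps) && (dist (c x) (c v) + r x < s j)].
(* Spheres in [B] may have any radius: a large one outside both [A] and [B] reaches within [3 * R0]
   of the centre and so belongs to [L]. *)
pose B := [set x in X | s j + r x < dist (c x) (c v)].
exists A, B.
have sepLZ : X :\: (A :|: B) \subset L :|: Z j.
  apply/subsetP => x; rewrite !inE => /andP[+ xX]; rewrite xX /=.
  have [small|large] := ltP (r x) eps; rewrite negb_or -!leNgt => /andP[h1 h2].
    by rewrite orbC ler_norml; apply/orP; left; apply/andP; split; lra.
  by rewrite orbF /=; lra.
have cardLZ : (J * #|L :|: Z j| <= 2 * #|X|)%N.
  rewrite (leq_trans (leq_mul (leqnn J) (leq_card_setU _ _))) //.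
  by rewrite mulnDr mul2n -addnn leq_add // ltnW.
have card_side (Y W : {set V}) : Y :\: (L :|: Z j) \subset W -> (#|Y| <= #|W| + #|L :|: Z j|)%N.
  move=> /subset_leq_card; have := cardsID (L :|: Z j) Y.
  by have := subset_leq_card (subsetIr Y (L :|: Z j)); lia.
have cardA : (#|cluster v w| <= #|A| + #|L :|: Z j|)%N.
  apply: card_side; apply/subsetP => x.
  rewrite !inE negb_or => /andP[/andP[+ +] /andP[xX]]; rewrite xX -/R0 distC /=.
  have := r_ge0 x; rewrite negb_and -!ltNge => rx /orP[->|] /=; last by lra.
  by rewrite -ltNge real_ltr_normr ?num_real // => /orP[] *; lra.
have cardB : (#|X :\: near| <= #|B| + #|L :|: Z j|)%N.
  apply: card_side; apply/subsetP => x.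
  rewrite !inE negb_or => /andP[/andP[+ +] /andP[+ xX]]; rewrite xX /= -ltNge distC.
  have [small|large] := ltP (r x) eps => /=; last by lra.
  by move=> _; rewrite -ltNge real_ltr_normr ?num_real // => /orP[] *; lra.
have card_far : (#|X| <= 2 * #|X :\: near|)%N.
  by have := cardsID near X; have := subset_leq_card (subsetIr X near); lia.
split.
- split.
  + by apply/subsetP => x; rewrite inE => /andP[].
  + by apply/subsetP => x; rewrite inE => /andP[].
  + rewrite -setI_eq0; apply/eqP/setP => x; rewrite !inE.
    by apply/negP => /andP[/and3P[_ _ h1] /andP[_ h2]]; have := r_ge0 x; lra.
  move=> a b; rewrite !inE => /and3P[_ _ ha] /andP[_ hb].
  have ab : a != b by apply/eqP => ab; move: ha; rewrite ab; have := r_ge0 b; lra.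
  rewrite e_meets //; apply/negP => /andP[_ le_ab].
  have := dist_triangle (c b) (c a) (c v); rewrite (distC (c b) (c a)); lra.
(* The separator takes at most [2 * #|X| / J], which by [big_J] is at most half of the
   [#|X| / kappa] centres in the cluster. *)
- move: cardA cardLZ vw_heavy big_J J_gt0; clear; move: #|A| #|L :|: _| #|cluster _ _|.
  move=> a l u; nia.
- move: cardB cardLZ card_far big_J kappa_ge2; clear; move: #|B| #|L :|: _| #|_ :\: near|.
  move=> a l u; nia.
- by rewrite (leq_trans _ cardLZ) // leq_mul2l subset_leq_card ?orbT.
Qed.

(** * Separators of sphere systems *)

(** In the touching case [#|P|] is at least [#|X| / M] with [M] of order [J ^ (d + 1)]. The chain
    cut has size of order [#|X| / q] and sides at least [q * t], with [q] of order [#|P| / t ^ 2];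
    it is sparse once [t ^ 3 * J * M ^ 2] is at most [#|X|], whence the exponent [2 * d + 3]. *)
Lemma sphere_system_separator (d : nat) : (0 < d)%N ->
  exists C : nat, forall (V : finType) (e : rel V) (c : V -> 'rV[R]_d) (r : V -> R)
      (t J : nat),
    symmetric e -> (forall v, 0 <= r v) ->
    (forall x y, x != y -> e x y = meets (fun u v => dist (c u) (c v)) r x y) ->
    ~ contains_Ktt t e -> (0 < t)%N -> (C <= J)%N ->
    (C * t ^ 3 * J ^ (2 * d + 3) <= #|V|)%N ->
    exists S : {set V}, balanced_separator e S /\ (J * #|S| <= C * #|V|)%N.
Proof.
move=> d_gt0; pose kappa := (2 * (13 * d) ^ d)%N.
have kappa_gt0 : (0 < kappa)%N by rewrite muln_gt0 expn_gt0 muln_gt0 d_gt0.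
(* The summands serve, in order, the chain cut, the concentric cut and the comparison of [J * M ^ 2]
   with [#|V|]. *)
exists (512 + 4 * kappa + 2 * ((8 * d) ^ d) ^ 2)%N; set C := (_ + _ + _)%N.
move=> V e c r t J e_sym r_ge0 e_meets noK t_gt0 big_J big_V.
have J_ge : (4 * kappa <= J)%N by rewrite (leq_trans _ big_J) // /C; lia.
apply: separator_of_sparse_cuts => // X big_X.
have X_gt0 : (0 < #|X|)%N by lia.
case: (geometric_cut d_gt0 J_ge X_gt0 r_ge0 e_meets); last first.
  rewrite -/kappa => -[A [B [cut cardA cardB cardS]]]; exists A, B.
  have C_ge (Y : {set V}) : (#|X| <= 2 * kappa * #|Y|)%N ->
      (J * #|X :\: (A :|: B)| <= C * #|Y|)%N.
    move=> cardY; rewrite (leq_trans cardS) // (@leq_trans (4 * kappa * #|Y|)) //; first lia.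
    by rewrite leq_mul2r; apply/orP; right; rewrite /C; lia.
  split; rewrite ?C_ge //.
  - by rewrite lt0n; apply: contraTneq cardA => ->; rewrite muln0 leqNgt X_gt0.
  - by rewrite lt0n; apply: contraTneq cardB => ->; rewrite muln0 leqNgt X_gt0.
move=> [P [sPX touching cardP]].
set M := (J * (8 * d * J) ^ d)%N in cardP.
have J_gt0 : (8 <= J)%N by lia.
have M_gt0 : (0 < M)%N by rewrite muln_gt0 expn_gt0 !muln_gt0 d_gt0; lia.
have H : (t ^ 3 * (J * M ^ 2) <= #|X|)%N.
  have JM : (J * M ^ 2 = ((8 * d) ^ d) ^ 2 * J ^ (2 * d + 3))%N.
    by rewrite /M [((8 * d * J) ^ d)%N]expnMn expnD [(2 * d)%N]mulnC expnM; ring.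
  have : (2 * (t ^ 3 * (J * M ^ 2)) <= #|V|)%N.
    apply: leq_trans big_V; rewrite JM.
    rewrite (_ : 2 * _ = (2 * ((8 * d) ^ d) ^ 2) * (t ^ 3 * J ^ (2 * d + 3)))%N; last by ring.
    by rewrite -[leqRHS]mulnA leq_mul2r; apply/orP; right; rewrite /C leq_addl.
  lia.
have P_ge : (t ^ 3 * (J * M) <= #|P|)%N.
  by rewrite -(@leq_pmul2l M) // (leq_trans _ cardP) // (leq_trans _ H) //; nia.
have P_ge8 : (8 * t ^ 2 <= #|P|)%N.
  have : (8 <= t * (J * M))%N by nia.
  move=> h; apply: leq_trans P_ge.
  rewrite (_ : t ^ 3 * (J * M) = t * (J * M) * t ^ 2)%N; last by ring.
  by rewrite leq_mul2r h orbT.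
(* The chain cut needs [6 * t ^ 2 * q + 2 * t] spheres, which is at most [8 * t ^ 2 * q]. *)
pose q := (#|P| %/ (8 * t ^ 2))%N.
have t2_gt0 : (0 < 8 * t ^ 2)%N by rewrite muln_gt0 expn_gt0 t_gt0.
have q_gt0 : (0 < q)%N by rewrite divn_gt0.
have q_le : (q * (8 * t ^ 2) <= #|P|)%N by apply: leq_trunc_div.
have q_ge : (#|P| <= q * (16 * t ^ 2))%N.
  have := ltn_ceil #|P| t2_gt0; rewrite -/q; move: q_gt0; clear; nia.
have big_P : (2 * t * (3 * t * q).+1 <= #|P|)%N.
  by apply: leq_trans q_le; move: q_gt0 t_gt0; clear; nia.
have [A [B [cut cardA cardB cardS]]] :=
  touching_cut (dist_pseudometric c) e_meets noK t_gt0 q_gt0 sPX touching big_P.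
exists A, B; have qt_gt0 : (0 < q * t)%N by rewrite muln_gt0 q_gt0.
have qtX : (q * t <= #|X|)%N.
  by case: cut => sAX _ _ _; rewrite (leq_trans cardA) // subset_leq_card.
(* Squaring [X_le] and cancelling one factor [#|X|] by means of [H] gives this bound; 256 is the
   square of 16. *)
have NJ : (#|X| * J <= 256 * (t * q ^ 2))%N.
  have X_le : (#|X| <= M * (q * (16 * t ^ 2)))%N.
    by rewrite (leq_trans cardP) // leq_mul2l q_ge orbT.
  have tM_gt0 : (0 < t ^ 3 * M ^ 2)%N by rewrite muln_gt0 !expn_gt0 t_gt0 M_gt0.
  rewrite -(leq_pmul2l tM_gt0).
  rewrite (_ : _ * (#|X| * J) = #|X| * (t ^ 3 * (J * M ^ 2)))%N; last by ring.
  rewrite (leq_trans (leq_mul (leqnn _) H)) // (leq_trans (leq_mul X_le X_le)) //.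
  by apply: eq_leq; ring.
have cardS' (Y : {set V}) : (q * t <= #|Y|)%N ->
    (J * #|X :\: (A :|: B)| <= C * #|Y|)%N.
  move=> qtY; apply: (@leq_trans (512 * (q * t))); last first.
    by apply: leq_mul; rewrite // /C; lia.
  rewrite -(@leq_pmul2l q) // mulnCA.
  rewrite (leq_trans (leq_mul (leqnn J) cardS)) //.
  by move: NJ qtX; clear; nia.
by split; rewrite ?cardS' // (leq_trans qt_gt0).
Qed.

(** The choice is [J], the integer part of [y / t]. If it is at most [C], the claimed bound exceeds
    [#|V|] and all vertices may be deleted. The root [y] is a parameter, which keeps the argument
    free of real powers. *)
Lemma sphere_system_bound (d : nat) : (0 < d)%N ->
  exists2 C : R, 0 < C & forall (V : finType) (e : rel V) (c : V -> 'rV[R]_d) (r : V -> R)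
      (t : nat) (y : R),
    symmetric e -> (forall v, 0 <= r v) ->
    (forall u v, u != v -> e u v = meets (fun u v => dist (c u) (c v)) r u v) ->
    ~ contains_Ktt t e -> (0 < t)%N -> 1 <= y -> y ^+ (2 * d + 8) = #|V|%:R ->
    exists S : {set V}, balanced_separator e S /\ #|S|%:R <= C * t%:R * (#|V|%:R / y).
Proof.
move=> d_gt0; have [C sep] := sphere_system_separator d_gt0.
exists (2 * C.+1%:R); first by rewrite mulr_gt0 ?ltr0n.
move=> V e c r t y e_sym r_ge0 e_meets noK t_gt0 y_ge1 yk.
have y_gt0 : 0 < y by lra.
have t_pos : 0 < t%:R :> R by rewrite ltr0n.
pose J := Num.truncn (y / t%:R).
have [small|big] := leqP C.+1 J; last first.
  exists setT; split; first by move=> x; rewrite inE.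
  rewrite cardsT (_ : _ * (_ / y) = 2 * (C.+1%:R * t%:R) / y * #|V|%:R); last by field; rewrite gt_eqF.
  rewrite ler_peMl // ler_pdivlMr // mul1r.
  have : y / t%:R < C.+1%:R by rewrite -truncn_lt_nat ?divr_ge0 ?ltW.
  rewrite ltr_pdivrMr // => h; rewrite (le_trans (ltW h)) // ler_peMl ?mulr_ge0 //; lra.
have yt_ge0 : 0 <= y / t%:R by rewrite divr_ge0 ?ltW.
have /andP[J_le J_gt] := truncn_itv yt_ge0; rewrite -/J in J_le J_gt.
rewrite ler_pdivlMr // in J_le; rewrite ltr_pdivrMr // in J_gt.
have J_gt0 : 0 < J%:R :> R by rewrite ltr0n (leq_trans _ small).
have big_V : (C * t ^ 3 * J ^ (2 * d + 3) <= #|V|)%N.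
  rewrite -(ler_nat R) -yk 2!natrM !natrX.
  (* Of the [2 * d + 8] factors [y], five absorb the constant and the others bound
     [t ^ 3 * J ^ (2 * d + 3)]. *)
  have Cy : C%:R <= y ^+ 5.
    rewrite (@le_trans _ _ J%:R) ?ler_nat ?(ltnW small) // (@le_trans _ _ (J%:R * t%:R)) //.
      by rewrite ler_peMr ?(ltW J_gt0) // ler1n.
    by rewrite (le_trans J_le) // ler_eXnr.
  rewrite (_ : (2 * d + 8) = 5 + (2 * d + 3))%N; last by lia.
  rewrite (exprD y) -mulrA; apply: (ler_pM _ _ Cy); rewrite ?mulr_ge0 ?exprn_ge0 ?ler0n //.
  apply: (@le_trans _ _ ((J%:R * t%:R) ^+ (2 * d + 3))).
    rewrite exprMn mulrC ler_wpM2l ?exprn_ge0 ?(ltW J_gt0) //.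
    by rewrite ler_weXn2l ?ler1n ?leq_addl.
  by rewrite ler_pXn2r ?nnegrE ?mulr_ge0 ?ler0n ?(ltW y_gt0) // addnS.
have [S [S_bal cardS]] := sep V e c r t J e_sym r_ge0 e_meets noK t_gt0 (ltnW small) big_V.
exists S; split => //.
have {}cardS : J%:R * #|S|%:R <= C.+1%:R * #|V|%:R :> R.
  by rewrite -!natrM ler_nat (leq_trans cardS) // leq_mul2r leqnSn orbT.
rewrite mulrA ler_pdivlMr //.
(* The factor 2 pays for rounding [y / t] down. *)
have y_le : y <= 2 * J%:R * t%:R.
  apply: (le_trans (ltW J_gt)); rewrite ler_wpM2r ?(ltW t_pos) // -natr1.
  have : 1 <= J%:R :> R by rewrite ler1n (leq_trans _ small).
  lra.
apply: (le_trans (ler_wpM2l (ler0n _ _) y_le)).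
rewrite (_ : _ * _ = 2 * t%:R * (J%:R * #|S|%:R)); last by ring.
rewrite (_ : _ * #|V|%:R = 2 * t%:R * (C.+1%:R * #|V|%:R)); last by ring.
by rewrite ler_wpM2l // mulr_ge0 // ltW.
Qed.

(** * Sphere graphs and circle graphs *)

Lemma sum_two (I : finType) (i0 i1 : I) (f : I -> R) :
  i0 != i1 -> (forall i, i != i0 -> i != i1 -> f i = 0) -> \sum_i f i = f i0 + f i1.
Proof.
move=> i01 f0; rewrite (bigD1 i0) //= (bigD1 i1) /=; last by rewrite eq_sym.
by rewrite big1 ?addr0 // => i /andP[]; apply: f0.
Qed.

(** Conversely, a common point is sought in the plane spanned by the line of centres and a vector
    [p] orthogonal to it, available since [d] is at least 2. *)
Lemma spheres_meetP (d : nat) (c1 c2 : 'rV[R]_d) (r1 r2 : R) :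
  (2 <= d)%N -> 0 < r1 -> 0 < r2 ->
  spheres_meet c1 r1 c2 r2 <-> `|r1 - r2| <= dist c1 c2 <= r1 + r2.
Proof.
move=> d_ge2 r1_gt0 r2_gt0; split=> [[x [x1 x2]]|].
  have {x1}x1 : dist x c1 = r1 by rewrite /dist x1 sqrtr_sqr gtr0_norm.
  have {x2}x2 : dist x c2 = r2 by rewrite /dist x2 sqrtr_sqr gtr0_norm.
  have := dist_triangle c1 x c2; have := dist_triangle x c1 c2.
  have := dist_triangle x c2 c1; rewrite (distC c1 x) (distC c2 c1) x1 x2 => *.
  by rewrite ler_norml; apply/andP; split; [apply/andP; split|]; lra.
rewrite ler_norml => /andP[/andP[lo1 lo2] hi].
pose w := c2 - c1.
pose i0 : 'I_d := Ordinal (ltnW d_ge2); pose i1 : 'I_d := Ordinal d_ge2.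
have [p [p_gt0 wp]] : exists p : 'rV[R]_d, 0 < \sum_i p ord0 i ^+ 2 /\
    \sum_i w ord0 i * p ord0 i = 0.
  pose p (a b : R) : 'rV[R]_d := \row_i (if i == i0 then a else if i == i1 then b else 0).
  have pE a b (g : 'I_d -> R -> R) : (forall i, g i 0 = 0) ->
      \sum_i g i (p a b ord0 i) = g i0 a + g i1 b.
    move=> g0; rewrite (@sum_two _ i0 i1) // => [|i ni0 ni1].
      by rewrite !mxE !eqxx.
    by rewrite mxE (negPf ni0) (negPf ni1).
  have sqr0 (i : 'I_d) : 0 ^+ 2 = 0 :> R by rewrite expr0n.
  have mul0 (i : 'I_d) : w ord0 i * 0 = 0 by rewrite mulr0.
  have pq a b := pE a b (fun _ x => x ^+ 2) sqr0.
  have wq a b := pE a b (fun i x => w ord0 i * x) mul0.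
  have [w0|w_neq0] := eqVneq (w ord0 i0) 0.
    by exists (p 1 0); rewrite pq wq w0 expr1n expr0n mul0r mulr0 !addr0.
  exists (p (- w ord0 i1) (w ord0 i0)); rewrite pq wq; split; last by ring.
  by rewrite ltr_wpDl ?sqr_ge0 // lt_neqAle sqr_ge0 eq_sym sqrf_eq0 w_neq0.
set D := dist c1 c2 in lo1 lo2 hi.
have D_ge0 : 0 <= D := dist_ge0 _ _.
have sumw : \sum_i w ord0 i ^+ 2 = D ^+ 2.
  by rewrite /D distC sqr_dist; apply: eq_bigr => i _; rewrite !mxE.
set q := \sum_i p ord0 i ^+ 2 in p_gt0.
(* The parameter on the line of centres where the two sphere equations agree; for concentric spheres
   the radii coincide and any value of [a] works. *)
pose a := (D ^+ 2 + r1 ^+ 2 - r2 ^+ 2) / (2 * D ^+ 2).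
have aD : 2 * a * D ^+ 2 = D ^+ 2 + r1 ^+ 2 - r2 ^+ 2.
  have [D0|D_neq0] := eqVneq D 0; last by rewrite /a; field.
  have -> : r1 = r2 by rewrite D0 in lo1 lo2; lra.
  by rewrite D0; ring.
have h_ge0 : 0 <= r1 ^+ 2 - a ^+ 2 * D ^+ 2.
  have [D0|D_neq0] := eqVneq D 0; first by rewrite D0 expr0n mulr0 subr0 sqr_ge0.
  (* Heron's factorisation: both factors are nonnegative by the triangle inequalities between [D],
     [r1] and [r2]. *)
  rewrite (_ : _ - _ = ((r2 ^+ 2 - (D - r1) ^+ 2) * ((D + r1) ^+ 2 - r2 ^+ 2)) / (2 * D) ^+ 2).
    rewrite divr_ge0 ?sqr_ge0 // mulr_ge0 // subr_ge0.
      by rewrite -ler_sqrt ?sqr_ge0 // !sqrtr_sqr (gtr0_norm r2_gt0) ler_norml; apply/andP; split; lra.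
    by rewrite ler_pXn2r ?nnegrE //; lra.
  by rewrite /a; field.
pose b := Num.sqrt ((r1 ^+ 2 - a ^+ 2 * D ^+ 2) / q).
have bq : b ^+ 2 * q = r1 ^+ 2 - a ^+ 2 * D ^+ 2.
  by rewrite sqr_sqrtr ?divr_ge0 ?(ltW p_gt0) // divfK // gt_eqF.
have normE s : \sum_i (s * w ord0 i + b * p ord0 i) ^+ 2 = s ^+ 2 * D ^+ 2 + b ^+ 2 * q.
  transitivity (\sum_i (s ^+ 2 * w ord0 i ^+ 2 + 2 * s * b * (w ord0 i * p ord0 i)
                        + b ^+ 2 * p ord0 i ^+ 2)).
    by apply: eq_bigr => i _; ring.
  by rewrite !big_split /= -!big_distrr /= wp sumw -/q mulr0 addr0.
exists (c1 + a *: w + b *: p); split; rewrite /on_sphere.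
  transitivity (\sum_i (a * w ord0 i + b * p ord0 i) ^+ 2); last by rewrite normE bq; ring.
  by apply: eq_bigr => i _; rewrite !mxE; ring.
transitivity (\sum_i ((a - 1) * w ord0 i + b * p ord0 i) ^+ 2).
  by apply: eq_bigr => i _; rewrite !mxE; ring.
rewrite normE bq; lra.
Qed.

(** * Chords of a circle as intervals of the line *)

Lemma norm_leE (x y : R) : (`|x| <= `|y|) = (x ^+ 2 <= y ^+ 2).
Proof. by rewrite -!sqrtr_sqr ler_sqrt ?sqr_ge0. Qed.

(** With [r1] and [r2] the half-lengths, the product equals [(m ^+ 2 - (r1 - r2) ^+ 2) * (m ^+ 2 -
    (r1 + r2) ^+ 2)]. It is nonpositive exactly when [m ^+ 2] lies between the two squares, which
    are distinct as both radii are positive. *)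
Lemma intervals_overlap (a b x y : R) : a != b -> x != y ->
  let m := (a + b) / 2 - (x + y) / 2 in
  (`| `|a - b| / 2 - `|x - y| / 2 | <= `|m| <= `|a - b| / 2 + `|x - y| / 2)
  = ((x - a) * (x - b) * ((y - a) * (y - b)) <= 0).
Proof.
move=> ab xy m; set r1 := `|a - b| / 2; set r2 := `|x - y| / 2.
have r1_gt0 : 0 < r1 by rewrite divr_gt0 // normr_gt0 subr_eq0.
have r2_gt0 : 0 < r2 by rewrite divr_gt0 // normr_gt0 subr_eq0.
have r1E : r1 ^+ 2 = (a - b) ^+ 2 / 4 by rewrite expr_div_n real_normK ?num_real //; field.
have r2E : r2 ^+ 2 = (x - y) ^+ 2 / 4 by rewrite expr_div_n real_normK ?num_real //; field.
rewrite norm_leE -[r1 + r2]gtr0_norm ?addr_gt0 // norm_leE.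
have -> : (x - a) * (x - b) * ((y - a) * (y - b)) =
    (m ^+ 2 - (r1 - r2) ^+ 2) * (m ^+ 2 - (r1 + r2) ^+ 2).
  transitivity ((m ^+ 2 - r1 ^+ 2 - r2 ^+ 2) ^+ 2 - 4 * r1 ^+ 2 * r2 ^+ 2); last by ring.
  by rewrite r1E r2E /m; field.
have : (r1 - r2) ^+ 2 < (r1 + r2) ^+ 2 by nra.
move: (_ ^+ 2) (_ ^+ 2) (_ ^+ 2) => M A B; clear => lt_AB.
by apply/andP/idP => [[h1 h2]|h]; [nra | split; nra].
Qed.

(** Twice the signed area of the triangle [p], [q], [x]; its sign tells the side of the line on
    which [x] lies. *)
Definition orient (p q x : 'rV[R]_2) :=
  (q ord0 0 - p ord0 0) * (x ord0 1 - p ord0 1) - (q ord0 1 - p ord0 1) * (x ord0 0 - p ord0 0).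

Lemma unit_circleP (p : 'rV[R]_2) :
  on_unit_circle p <-> p ord0 0 ^+ 2 + p ord0 1 ^+ 2 = 1.
Proof.
rewrite /on_unit_circle /dist2 !big_ord_recl big_ord0 !mxE !subr0 addr0.
by have -> : lift ord0 ord0 = 1 :> 'I_2 by apply: val_inj.
Qed.

Lemma row2P (p q : 'rV[R]_2) : p ord0 0 = q ord0 0 -> p ord0 1 = q ord0 1 -> p = q.
Proof.
move=> h0 h1; apply/rowP => i; case: i => [[|[|//]] lt_i].
  by have -> : Ordinal lt_i = 0 by apply: val_inj.
by have -> : Ordinal lt_i = 1 by apply: val_inj.
Qed.

(** One sign condition suffices: if [x] and [y] are not strictly on the same side, their chord meets
    the line through [p] and [q] at a point of the disc, and the line meets the disc exactly in the
    chord. *)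
Lemma chords_cross (p q x y : 'rV[R]_2) :
  on_unit_circle p -> on_unit_circle q -> on_unit_circle x -> on_unit_circle y -> p != q ->
  (exists z, on_segment p q z /\ on_segment x y z) <-> orient p q x * orient p q y <= 0.
Proof.
move=> /unit_circleP Up /unit_circleP Uq /unit_circleP Ux /unit_circleP Uy pq; split.
  move=> [z [[s [s0 [s1 zs]]] [u [u0 [u1 zu]]]]].
  have : (1 - u) * orient p q x + u * orient p q y = 0.
    transitivity (orient p q z); first by rewrite zu /orient !mxE; ring.
    by rewrite zs /orient !mxE; ring.
  move: (orient p q x) (orient p q y) => a b ab; rewrite leNgt; apply/negP => ab_gt0.
  have : (1 - u) * a ^+ 2 + u * (a * b) = 0.
    by rewrite -(mulr0 a) -ab; ring.
  have : 0 < a ^+ 2 by rewrite lt_neqAle sqr_ge0 eq_sym sqrf_eq0; case: eqVneq ab_gt0 => // ->; rewrite mul0r ltxx.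
  move: (a ^+ 2) (a * b) ab_gt0 => A B; clear -u0 u1; nra.
move=> ab_le0.
have [u [u0 [u1 uab]]] : exists u, 0 <= u /\ u <= 1 /\
    (1 - u) * orient p q x + u * orient p q y = 0.
  move: (orient p q x) (orient p q y) ab_le0 => a b ab_le0.
  have [a0|a_neq0] := eqVneq a 0; first by exists 0; rewrite a0; split; [|split]; lra.
  have a2_gt0 : 0 < a ^+ 2 by rewrite lt_neqAle sqr_ge0 eq_sym sqrf_eq0 a_neq0.
  have den : 0 < a ^+ 2 - a * b by lra.
  (* This is [a / (a - b)], expanded by [a] to make the denominator positive. *)
  exists (a ^+ 2 / (a ^+ 2 - a * b)); split; first by rewrite divr_ge0 ?sqr_ge0 ?(ltW den).
  split; first by rewrite ler_pdivrMr //; lra.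
  by field; rewrite gt_eqF.
pose z := (1 - u) *: x + u *: y; exists z; split; last by exists u.
set n := (q ord0 0 - p ord0 0) ^+ 2 + (q ord0 1 - p ord0 1) ^+ 2.
have n_gt0 : 0 < n.
  rewrite lt_neqAle addr_ge0 ?sqr_ge0 // andbT eq_sym paddr_eq0 ?sqr_ge0 // !sqrf_eq0 !subr_eq0.
  by apply: contra pq => /andP[/eqP h0 /eqP h1]; apply/eqP/row2P.
have oz : orient p q z = 0.
  by rewrite -uab /orient !mxE; ring.
pose s := ((z ord0 0 - p ord0 0) * (q ord0 0 - p ord0 0)
          + (z ord0 1 - p ord0 1) * (q ord0 1 - p ord0 1)) / n.
have proj (a b f g : R) : a * g = b * f -> a ^+ 2 + b ^+ 2 != 0 ->
    f = (f * a + g * b) / (a ^+ 2 + b ^+ 2) * a.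
  move=> ag nz; rewrite mulrAC (_ : (f * a + g * b) * a = f * (a ^+ 2 + b ^+ 2)) ?mulfK //.
  by rewrite mulrDl mulrAC [g * b * a]mulrC mulrA ag; ring.
have n_neq0 : n != 0 by rewrite gt_eqF.
have oz' : (q ord0 0 - p ord0 0) * (z ord0 1 - p ord0 1)
    = (q ord0 1 - p ord0 1) * (z ord0 0 - p ord0 0) by apply/eqP; rewrite -subr_eq0 -/(orient p q z) oz.
have z0 : z ord0 0 = (1 - s) * p ord0 0 + s * q ord0 0.
  have := proj _ _ _ _ oz' n_neq0; rewrite -/n -/s => h.
  by rewrite -[LHS](subrK (p ord0 0)) h; ring.
have z1 : z ord0 1 = (1 - s) * p ord0 1 + s * q ord0 1.
  have := proj _ _ _ _ (esym oz'); rewrite [_ ^+ 2 + _]addrC -/n => /(_ n_neq0).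
  rewrite [_ * _ + _]addrC -/s => h.
  by rewrite -[LHS](subrK (p ord0 1)) h; ring.
have z_le1 : z ord0 0 ^+ 2 + z ord0 1 ^+ 2 <= 1.
  rewrite (_ : _ + _ = (1 - u) * (x ord0 0 ^+ 2 + x ord0 1 ^+ 2) + u * (y ord0 0 ^+ 2 + y ord0 1 ^+ 2)
     - u * (1 - u) * ((x ord0 0 - y ord0 0) ^+ 2 + (x ord0 1 - y ord0 1) ^+ 2)); last first.
    by rewrite !mxE; ring.
  rewrite Ux Uy !mulr1 subrK gerBl; apply: mulr_ge0; last by rewrite addr_ge0 ?sqr_ge0.
  by apply: mulr_ge0; lra.
(* A point of the line with parameter [s] has squared norm [1 - s * (1 - s) * n], which is at most 1
   in the disc. *)
have : 0 <= s * (1 - s) * n.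
  move: z_le1; rewrite z0 z1.
  rewrite (_ : _ + _ = (1 - s) * (p ord0 0 ^+ 2 + p ord0 1 ^+ 2) + s * (q ord0 0 ^+ 2 + q ord0 1 ^+ 2)
     - s * (1 - s) * n); last by rewrite /n; ring.
  by rewrite Up Uq !mulr1 subrK gerBl.
rewrite pmulr_lge0 // => s_itv; exists s.
have {}s_itv : s ^+ 2 <= s by move: s_itv; rewrite mulrBr mulr1 subr_ge0 expr2.
split; first by rewrite (le_trans _ s_itv) ?sqr_ge0.
split; first by rewrite leNgt; apply/negP => s_gt1; nra.
by apply: row2P; rewrite ?z0 ?z1 !mxE.
Qed.

(** Inverse stereographic projection from [w] of the point with coordinate [a] on the line through
    the origin orthogonal to [w]. *)
Definition stereographic (w p : 'rV[R]_2) (a : R) : Prop :=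
  p ord0 0 = ((a ^+ 2 - 1) * w ord0 0 + 2 * a * w ord0 1) / (1 + a ^+ 2) /\
  p ord0 1 = ((a ^+ 2 - 1) * w ord0 1 - 2 * a * w ord0 0) / (1 + a ^+ 2).

Lemma stereographic_ex (w p : 'rV[R]_2) :
  on_unit_circle w -> on_unit_circle p -> p != w -> exists a, stereographic w p a.
Proof.
move=> /unit_circleP Uw /unit_circleP Up pw.
set f := p ord0 0 * w ord0 0 + p ord0 1 * w ord0 1.
set g := p ord0 0 * w ord0 1 - p ord0 1 * w ord0 0.
have fg : f ^+ 2 + g ^+ 2 = 1.
  transitivity ((p ord0 0 ^+ 2 + p ord0 1 ^+ 2) * (w ord0 0 ^+ 2 + w ord0 1 ^+ 2)).
    by rewrite /f /g; ring.
  by rewrite Up Uw mulr1.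
have f_neq1 : 1 - f != 0.
  apply: contra pw => /eqP f1; have {}f1 : f = 1 by lra.
  have : (p ord0 0 - w ord0 0) ^+ 2 + (p ord0 1 - w ord0 1) ^+ 2 = 0.
    transitivity ((p ord0 0 ^+ 2 + p ord0 1 ^+ 2) + (w ord0 0 ^+ 2 + w ord0 1 ^+ 2) - 2 * f).
      by rewrite /f; ring.
    by rewrite Up Uw f1; ring.
  move/eqP; rewrite paddr_eq0 ?sqr_ge0 // !sqrf_eq0 !subr_eq0 => /andP[/eqP h0 /eqP h1].
  by apply/eqP/row2P.
exists (g / (1 - f)).
have den : 1 + (g / (1 - f)) ^+ 2 = 2 / (1 - f).
  have g2 : g ^+ 2 = (1 - f) * (1 + f) by move: fg; clear; lra.
  by rewrite expr_div_n g2; field.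
have sq : (g / (1 - f)) ^+ 2 - 1 = 2 / (1 - f) - 2 by rewrite -den; ring.
have p0 : p ord0 0 = f * w ord0 0 + g * w ord0 1.
  transitivity (p ord0 0 * (w ord0 0 ^+ 2 + w ord0 1 ^+ 2)); first by rewrite Uw mulr1.
  by rewrite /f /g; ring.
have p1 : p ord0 1 = f * w ord0 1 - g * w ord0 0.
  transitivity (p ord0 1 * (w ord0 0 ^+ 2 + w ord0 1 ^+ 2)); first by rewrite Uw mulr1.
  by rewrite /f /g; ring.
rewrite /stereographic den sq p0 p1; split; field; exact: f_neq1.
Qed.

(** For fixed [p] and [q], multiplying the values at two points [x] leaves, up to a positive factor
    when [a != b], the product that decides whether intervals cross. *)
Lemma orient_stereographic (w p q x : 'rV[R]_2) (a b z : R) : on_unit_circle w ->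
  stereographic w p a -> stereographic w q b -> stereographic w x z ->
  orient p q x = 4 * (b - a) * ((z - a) * (z - b)) / ((1 + a ^+ 2) * (1 + b ^+ 2) * (1 + z ^+ 2)).
Proof.
move=> /unit_circleP Uw [p0 p1] [q0 q1] [x0 x1].
(* The left side is quadratic in [w]; inserting the squared norm of [w] makes both sides
   homogeneous. *)
rewrite -[RHS]mul1r -[X in _ = X * _]Uw /orient p0 p1 q0 q1 x0 x1; field.
by rewrite !gt_eqF // ltr_wpDr ?sqr_ge0.
Qed.

Lemma unit_circle_avoid (s : seq 'rV[R]_2) : exists2 w, on_unit_circle w & w \notin s.
Proof.
pose P (n : nat) : 'rV[R]_2 := \row_i (if i == 0 then (1 - n%:R ^+ 2) / (1 + n%:R ^+ 2)
                                        else 2 * n%:R / (1 + n%:R ^+ 2)).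
have den (n : nat) : 1 + n%:R ^+ 2 != 0 :> R by rewrite gt_eqF // ltr_wpDr ?sqr_ge0.
have PE (n : nat) : P n ord0 0 = (1 - n%:R ^+ 2) / (1 + n%:R ^+ 2) /\
    P n ord0 1 = 2 * n%:R / (1 + n%:R ^+ 2) by rewrite !mxE.
have P_inj : injective P.
  move=> m n Pmn; apply/eqP; rewrite -(eqr_nat R); apply/eqP.
  (* The slope seen from the point (-1, 0) recovers [k] from [P k]. *)
  have PK (k : nat) : P k ord0 1 / (1 + P k ord0 0) = k%:R.
    have [-> ->] := PE k; field; rewrite den /= (_ : _ + _ = 2) ?pnatr_eq0 //; ring.
  by rewrite -(PK m) -(PK n) Pmn.
case: (boolP (all (fun n => P n \in s) (iota 0 (size s).+1))) => [/allP all_s|/allPn [n _ ns]].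
  have : (size (map P (iota 0 (size s).+1)) <= size s)%N.
    apply: uniq_leq_size; first by rewrite map_inj_uniq ?iota_uniq.
    by move=> x /mapP [n /all_s ns ->].
  by rewrite size_map size_iota ltnn.
exists (P n) => //; apply/unit_circleP; have [-> ->] := PE n; field; exact: den.
Qed.

(** The metric criterion replaces actual intersection, so that dimension one, where it describes
    circle graphs, is treated uniformly. *)
Definition sphere_system (d : nat) (V : finType) (e : rel V) (c : V -> 'rV[R]_d) (r : V -> R) :=
  (forall v, 0 <= r v) /\
  (forall u v, u != v -> e u v = meets (fun u v => dist (c u) (c v)) r u v).

(* Projecting the circle stereographically from a point [w] that is no endpoint turns
   chords into intervals, and crossing chords into intervals neither nested nor
   disjoint, that is, into crossing spheres of dimension one. *)
Lemma circle_graph_system (V : finType) (e : rel V) :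
  circle_graph e -> exists (c : V -> 'rV[R]_1) r, sphere_system e c r.
Proof.
move=> [p [q [chord e_cross]]].
have [w Uw] := unit_circle_avoid ([seq p v | v : V] ++ [seq q v | v : V]).
rewrite mem_cat negb_or => /andP[wp wq].
have pw v : p v != w by apply: contraNneq wp => <-; apply: image_f.
have qw v : q v != w by apply: contraNneq wq => <-; apply: image_f.
have Up v : on_unit_circle (p v) by case: (chord v).
have Uq v : on_unit_circle (q v) by case: (chord v) => _ [].
have pq v : p v != q v by case: (chord v) => _ [].
have /fin_all_exists [a aP] := fun v => stereographic_ex Uw (Up v) (pw v).
have /fin_all_exists [b bP] := fun v => stereographic_ex Uw (Uq v) (qw v).
have ab v : a v != b v.
  apply: contra (pq v) => /eqP abv; apply/eqP/row2P.
    by rewrite (aP v).1 (bP v).1 abv.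
  by rewrite (aP v).2 (bP v).2 abv.
exists (fun v => const_mx ((a v + b v) / 2)), (fun v => `|a v - b v| / 2).
split=> [v|u v uv]; first by rewrite divr_ge0.
have distE (x y : R) : dist (const_mx x : 'rV[R]_1) (const_mx y) = `|x - y|.
  by rewrite /dist /dist2 big_ord1 !mxE sqrtr_sqr.
rewrite /meets distE intervals_overlap //.
have pos (z : R) : 0 < 1 + z ^+ 2 by rewrite ltr_wpDr ?sqr_ge0.
pose K := (4 * (b u - a u) / ((1 + a u ^+ 2) * (1 + b u ^+ 2))) ^+ 2
          / ((1 + a v ^+ 2) * (1 + b v ^+ 2)).
have K_gt0 : 0 < K.
  apply: divr_gt0; last by rewrite mulr_gt0.
  rewrite lt_neqAle sqr_ge0 eq_sym sqrf_eq0 andbT; apply: mulf_neq0.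
    by rewrite mulf_neq0 ?pnatr_eq0 // subr_eq0 eq_sym.
  by rewrite invr_eq0 mulf_neq0 // gt_eqF.
rewrite -(pmulr_rle0 _ K_gt0) (_ : K * _ = orient (p u) (q u) (p v) * orient (p u) (q u) (q v)).
  have := chords_cross (Up u) (Uq u) (Up v) (Uq v) (pq u); have := e_cross u v uv.
  by move=> h1 h2; apply/idP/idP => [/h1/h2|/h2/h1].
rewrite (orient_stereographic Uw (aP u) (bP u) (aP v)).
rewrite (orient_stereographic Uw (aP u) (bP u) (bP v)) /K; field.
by rewrite !gt_eqF.
Qed.

Lemma in_S_system (d : nat) (V : finType) (e : rel V) : (1 <= d)%N -> in_S d e ->
  exists (c : V -> 'rV[R]_d) r, sphere_system e c r.
Proof.
rewrite /in_S => d_gt0; case: eqVneq => [->|d_neq1]; first exact: circle_graph_system.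
move=> [c [r [r_gt0 e_meets]]]; exists c, r; split=> [v|u v uv]; first exact: ltW.
have d_ge2 : (2 <= d)%N by lia.
by apply/idP/idP => [/(e_meets u v uv)/spheres_meetP|/spheres_meetP h]; 
  [apply | apply/(e_meets u v uv); apply: h].
Qed.

(** Padding centres with zero coordinates preserves distances, hence the criterion. *)
Lemma sphere_dim_system (d : nat) (V : finType) (e : rel V) : sphere_dim_le d e ->
  exists (c : V -> 'rV[R]_d) r, sphere_system e c r.
Proof.
move=> [d' [d'_gt0 [le_d /(in_S_system d'_gt0) [c [r [r_ge0 e_meets]]]]]].
rewrite -(subnKC le_d); move: (d - d')%N => k.
exists (fun v => row_mx (c v) (0 : 'rV_k)), r; split=> // u v uv; rewrite e_meets // /meets.
suff -> : dist (c u) (c v) = dist (row_mx (c u) (0 : 'rV_k)) (row_mx (c v) 0) by [].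
congr Num.sqrt; rewrite /dist2 big_split_ord /= [X in _ + X]big1 ?addr0 => [|i _].
  by apply: eq_bigr => i _; rewrite !row_mxEl.
by rewrite !row_mxEr !mxE subrr expr0n.
Qed.

(** * Induced subgraphs, real powers and the final bounds *)

Lemma separator_bound (d : nat) : (0 < d)%N ->
  exists2 C : R, 0 < C & forall (V : finType) (e : rel V) (t : nat) (y : R),
    S_dt d t e -> (0 < t)%N -> 1 <= y -> y ^+ (2 * d + 8) = #|V|%:R ->
    exists S : {set V}, balanced_separator e S /\ #|S|%:R <= C * t%:R * (#|V|%:R / y).
Proof.
move=> /sphere_system_bound [C C_gt0 sep]; exists C => // V e t y.
move=> [[e_sym _] [/sphere_dim_system [c [r [r_ge0 e_meets]]] noK]].
exact: sep V e c r t y e_sym r_ge0 e_meets noK.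
Qed.

Lemma S_dt_induced (d t : nat) (W V : finType) (h : rel W) (e : rel V) :
  S_dt d t e -> induced_sub h e -> S_dt d t h.
Proof.
move=> [[e_sym e_irr] [[d' [d'_gt0 [le_d e_S]]] noK]] [f [f_inj hE]].
split; first by split=> [x y|x]; rewrite !hE.
split.
  exists d'; split=> //; split=> //; move: e_S; rewrite /in_S; case: ifP => _.
    move=> [p [q [chord e_cross]]]; exists (p \o f), (q \o f).
    split=> [v|u v uv /=]; first exact: chord.
    by rewrite hE; apply: e_cross; rewrite (inj_eq f_inj).
  move=> [c [r [r_gt0 e_meet]]]; exists (c \o f), (r \o f).
  split=> [v|u v uv /=]; first exact: r_gt0.
  by rewrite hE; apply: e_meet; rewrite (inj_eq f_inj).
move=> [A [B [cardA [cardB [dAB hAB]]]]]; apply: noK.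
exists (f @: A), (f @: B); rewrite !card_imset //; split=> //; split=> //; split.
  rewrite -setI_eq0 -imsetI; last by move=> x y _ _; apply: f_inj.
  by rewrite (eqP (_ : A :&: B == set0)) ?imset0 // setI_eq0.
move=> _ _ /imsetP [a aA ->] /imsetP [b bB ->].
by rewrite -hE hAB.
Qed.

Lemma Rpower_root (n k : nat) : (0 < n)%N -> (0 < k)%N ->
  exists y : R, [/\ 1 <= y, y ^+ k = n%:R & Rpower n%:R (1 - 1 / k%:R) = n%:R / y :> R].
Proof.
move=> n_gt0 k_gt0; exists (Rpower n%:R (1 / k%:R)).
have n_pos : Rlt 0 n%:R by apply/RltP; rewrite ltr0n.
set y := Rpower _ _; have y_gt0 : 0 < y by apply/RltP; apply: Exp_prop.exp_pos.
have yk : y ^+ k = n%:R.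
  rewrite -RpowE -Rpower_pow; last exact/RltP.
  rewrite Rpower_mult INRE (_ : Rmult _ _ = 1); first exact: Rpower_1.
  by rewrite RmultE RdivE divfK // pnatr_eq0 -lt0n.
split=> //.
  by rewrite -(@ler_pXn2r _ k) ?nnegrE ?(ltW y_gt0) // expr1n yk ler1n.
by rewrite Rpower_plus Rpower_Ropp Rpower_1 // RmultE RinvE.
Qed.

(** Lets the logarithmic factor be inserted at the cost of a constant 2. *)
Lemma half_le_ln (n : nat) : (2 <= n)%N -> 1 <= 2 * ln n%:R.
Proof.
move=> n_ge2; have ln2 : 2^-1 < ln 2%:R.
  by have /RltP := ln_lt_2; rewrite RinvE.
have : ln 2%:R <= ln n%:R.
  have [->//|n_neq2] := eqVneq n 2%N.
  apply/ltW/RltP/ln_increasing; apply/RltP; first by rewrite ltr0n.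
  by rewrite ltr_nat; lia.
lra.
Qed.

Theorem theorem1p1 :
  forall d : nat, (2 <= d)%N ->
    (exists C : R, 0 < C /\
      forall t : nat, (2 <= t)%N ->
      forall (V : finType) (e : rel V), S_dt d t e -> (2 <= #|V|)%N ->
        exists S : {set V}, balanced_separator e S /\
          #|S|%:R <= C * t%:R ^+ 10
                     * Rpower (#|V|%:R) (1 - 1 / (2 * d + 8)%N%:R)
                     * ln (#|V|%:R))
    /\ (forall t : nat, (2 <= t)%N -> strongly_sublinear (S_dt d t)).
Proof.
move=> d d_ge2; have [C C_gt0 sep] := separator_bound (ltnW d_ge2).
have k_gt0 : (0 < 2 * d + 8)%N by rewrite addnS.
split.
  exists (2 * C); split=> [|t t_ge2 V e eS V_ge2]; first by rewrite mulr_gt0.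
  have [y [y_ge1 yk ->]] := Rpower_root (ltnW V_ge2) k_gt0.
  have [S [S_bal cardS]] := sep V e t y eS (ltnW t_ge2) y_ge1 yk.
  exists S; split=> //; apply: le_trans cardS _.
  have ny_ge0 : 0 <= #|V|%:R / y by rewrite divr_ge0 //; lra.
  have t_le : t%:R <= t%:R ^+ 10 :> R by rewrite ler_eXnr // ler1n ltnW.
  rewrite (_ : _ * ln _ = C * t%:R ^+ 10 * (#|V|%:R / y) * (2 * ln #|V|%:R)); last by ring.
  rewrite (@le_trans _ _ (C * t%:R ^+ 10 * (#|V|%:R / y))) //.
    by rewrite ler_wpM2r // ler_wpM2l // ltW.
  by rewrite ler_peMr ?half_le_ln // mulr_ge0 // mulr_ge0 ?exprn_ge0 // ltW.
move=> t t_ge2; exists (Rdiv 1 (2 * d + 8)%N%:R); split.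
  by rewrite RdivE divr_gt0 // ltr0n.
exists (C * t%:R) => W h [V [e [eS /(S_dt_induced eS) hS]]].
(* The root needs a positive argument. For the empty graph, [Rpower] is still positive, being an
   exponential. *)
have [W0|W_gt0] := posnP #|W|.
  exists set0; split; first by move=> x; case: (fintype0 x).
  rewrite cards0 !mulr_ge0 ?(ltW C_gt0) // ltW //.
  by apply/RltP; apply: Exp_prop.exp_pos.
have [y [y_ge1 yk ->]] := Rpower_root W_gt0 k_gt0.
exact: sep W h t y hS (ltnW t_ge2) y_ge1 yk.
Qed.
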